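(* Let $q$ be a prime with $q\equiv 1\pmod 4$ and let $\xi$ be an element of order $4$ in $\mathbb{Z}_q^\times$. Up to isomorphism, the left braces of size $4q$ with cyclic additive group and with $|\ker\lambda|=q$ are exactly the two braces $B_1$ and $B_2$, which are not isomorphic to each other, defined on $\mathbb{Z}_q\times\mathbb{Z}_4$ with componentwise addition $\begin{pmatrix} n\\ m\end{pmatrix}+\begin{pmatrix} x\\ y\end{pmatrix}=\begin{pmatrix} n+x\\ m+y\end{pmatrix}$ and $$B_1:\ \begin{pmatrix} n\\ m\end{pmatrix}\circ\begin{pmatrix} x\\ y\end{pmatrix}=\begin{pmatrix} n+(-1)^{\frac{m(m-1)}{2}}x\\ m+(-1)^m y\end{pmatrix},\qquad B_2:\ \begin{pmatrix} n\\ m\end{pmatrix}\circ\begin{pmatrix} x\\ y\end{pmatrix}=\begin{pmatrix} n+\xi^m x\\ m+y\end{pmatrix}$$ for $0\le n,x\le q-1$ and $0\le m,y\le 3$ (components taken modulo $q$ and modulo $4$ respectively). In particular, $B_2$ is a bi-skew brace, $(B_1,\circ)\cong\mathbb{Z}_2\times(\mathbb{Z}_q\rtimes_{-1}\mathbb{Z}_2)$ and $(B_2,\circ)\cong\mathbb{Z}_q\rtimes_\xi\mathbb{Z}_4$.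
   Context: A skew (left) brace is a triple $(B,+,\circ)$ where $(B,+)$ and $(B,\circ)$ are groups such that $a\circ(b+c)=a\circ b-a+a\circ c$ for all $a,b,c\in B$; it is a left brace if $(B,+)$ is abelian, and a bi-skew brace if $(B,\circ,+)$ is also a skew brace. The map $\lambda:(B,\circ)\to\mathrm{Aut}(B,+)$, $\lambda_a(b)=-a+a\circ b$, is a group homomorphism, with kernel $\ker\lambda$. Isomorphisms are bijections preserving both operations. $\mathbb{Z}_q\rtimes_\xi\mathbb{Z}_4=\langle\sigma,\tau\mid\sigma^4=\tau^q=1,\ \sigma\tau\sigma^{-1}=\tau^\xi\rangle$, and $\mathbb{Z}_q\rtimes_{-1}\mathbb{Z}_2$ is the dihedral group of order $2q$. *)

(* Defs.v *)
From HB Require Import structures.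
From mathcomp Require Import all_boot all_algebra all_fingroup all_solvable.

Set Implicit Arguments.
Unset Strict Implicit.
Unset Printing Implicit Defensive.

(* A skew brace carries two group structures on one type, so they cannot both
   be canonical instances on it; a group structure is therefore first an
   explicit record. *)
Record group_on (T : Type) := GroupOn {
  gop : T -> T -> T;
  gid : T;
  ginv : T -> T;
  gopA : associative gop;
  gop1g : left_id gid gop;
  gopVg : left_inverse gid ginv gop
}.

Definition skew_brace_axiom (T : Type) (add circ : group_on T) : Prop :=
  forall a b c : T,
    gop circ a (gop add b c) =
    gop add (gop add (gop circ a b) (ginv add a)) (gop circ a c).

Record skew_brace (T : Type) := SkewBrace {
  badd : group_on T;
  bcirc : group_on T;
  skew_braceP : skew_brace_axiom badd bcirc
}.

Definition is_left_brace (T : Type) (B : skew_brace T) : Prop :=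
  commutative (gop (badd B)).

Definition is_bi_skew_brace (T : Type) (B : skew_brace T) : Prop :=
  skew_brace_axiom (bcirc B) (badd B).

Definition brace_iso (T T' : Type) (B : skew_brace T) (B' : skew_brace T') :
    Prop :=
  exists f : T -> T',
    [/\ bijective f,
        {morph f : x y / gop (badd B) x y >-> gop (badd B') x y}
      & {morph f : x y / gop (bcirc B) x y >-> gop (bcirc B') x y}].

Definition blambda (T : Type) (B : skew_brace T) (a b : T) : T :=
  gop (badd B) (ginv (badd B) a) (gop (bcirc B) a b).

Definition ker_blambda (T : finType) (B : skew_brace T) : {set T} :=
  [set a | [forall b, blambda B a b == b]].

(* A copy of T whose finGroupType structure is G, written multiplicatively. *)
Definition carrier (T : finType) (G : group_on T) : Type := T.

HB.instance Definition _ (T : finType) (G : group_on T) :=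
  Finite.on (carrier G).

HB.instance Definition _ (T : finType) (G : group_on T) :=
  Finite_isGroup.Build (carrier G) (@gopA T G) (@gop1g T G) (@gopVg T G).

(* Main.v *)
Require Import Defs.
From HB Require Import structures.
From mathcomp Require Import all_boot all_algebra all_fingroup all_solvable.
From mathcomp Require Import ring.

Set Implicit Arguments.
Unset Strict Implicit.
Unset Printing Implicit Defensive.

Import GRing.Theory.
Local Open Scope ring_scope.

(** The multiplication of a left brace on [Z_q x Z_4] is
    [a o b = a + lambda_a(b)], and since [q] and [4] are coprime every
    additive endomorphism is diagonal.  As [q = 1] mod 4, the only additive
    subgroup of order [q] is [Z_q x 0]; when it is the kernel of [lambda],
    [lambda_(n,m) = diag(u m, v m)] depends on [m] only, where
    [u (m + v m y) = u m u y], [v (m + v m y) = v m v y] and [(u, v)] is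
    trivial only at [0].  If [v 1 = 1] then [v] is constant and
    [u m = (u 1) ^ m] with [u 1] of order 4, i.e. [u 1 = xi] or [xi^-1].
    Otherwise [v m = (-1) ^ m], [u 2 = -1] and [u 1 = 1] or [-1].  In each case
    the two possibilities are exchanged by [m |-> -m].  The two braces are
    distinguished by [lambda_(a o a)], which is trivial in the first one only. *)

(** * Cancellation laws for explicit group structures *)

Section GroupOn.

Variables (T : Type) (G : group_on T).
Local Notation "x ** y" := (gop G x y) (at level 40, left associativity).
Local Notation "x ^^" := (ginv G x) (at level 2, format "x ^^").

Lemma gopVK a b : a^^ ** (a ** b) = b.
Proof. by rewrite gopA gopVg gop1g. Qed.

Lemma gop_inj a : injective (gop G a).
Proof. by move=> b c eq_bc; rewrite -(gopVK a b) eq_bc gopVK. Qed.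

Lemma gopgV a : a ** a^^ = gid G.
Proof. by rewrite -[LHS](gopVK a^^) [a^^ ** _]gopVK gopVg. Qed.

Lemma gopg1 a : a ** gid G = a.
Proof. by rewrite -(gopVg G a) gopA gopgV gop1g. Qed.

Lemma gopKV a b : a ** (a^^ ** b) = b.
Proof. by rewrite gopA gopgV gop1g. Qed.

End GroupOn.

(** * The map lambda of a skew brace *)

Section SkewBrace.

Variables (T : Type) (B : skew_brace T).
Local Notation add := (gop (badd B)).
Local Notation circ := (gop (bcirc B)).
Local Notation lam := (blambda B).

(** With [e] the identity of [circ], the brace axiom at [e], 0, 0 reads 0 = -e. *)
Lemma brace_gid : gid (bcirc B) = gid (badd B).
Proof.
have := skew_braceP B (gid (bcirc B)) (gid (badd B)) (gid (badd B)).
rewrite -gopA !gop1g gopg1 => inv_e.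
by rewrite -(gopg1 (badd B) (gid (bcirc B))) inv_e gopgV.
Qed.

Lemma circE a b : circ a b = add a (lam a b).
Proof. by rewrite gopKV. Qed.

Lemma blambda_id b : lam (gid (badd B)) b = b.
Proof.
apply: (@gop_inj _ (badd B) (gid (badd B))).
by rewrite -circE [RHS]gop1g -brace_gid gop1g.
Qed.

Lemma blambdaD a b c : lam a (add b c) = add (lam a b) (lam a c).
Proof. by rewrite /blambda skew_braceP !gopA. Qed.

(** After adding [circ a b] on the left, this is associativity of [circ] combined with additivity of
    [lam a]. *)
Lemma blambda_circ a b c : lam (circ a b) c = lam a (lam b c).
Proof.
apply: (@gop_inj _ (badd B) (circ a b)); rewrite -circE -gopA [in LHS]circE.
by rewrite [circ b c]circE blambdaD gopA -!circE.
Qed.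

Lemma blambda_inj a : injective (lam a).
Proof. by move=> b c eq_bc; apply: gop_inj (gop_inj eq_bc). Qed.

End SkewBrace.

(** * Invariants of brace isomorphisms *)

Section BraceIso.

Variables (T T' : finType) (B : skew_brace T) (B' : skew_brace T').
Variable f : T -> T'.
Hypotheses (f_bij : bijective f)
  (fD : {morph f : x y / gop (badd B) x y >-> gop (badd B') x y})
  (fM : {morph f : x y / gop (bcirc B) x y >-> gop (bcirc B') x y}).

Lemma brace_iso_opp x : f (ginv (badd B) x) = ginv (badd B') (f x).
Proof.
have f1 : f (gid (badd B)) = gid (badd B').
  by apply: (@gop_inj _ (badd B') (f (gid (badd B)))); rewrite -fD gop1g gopg1.
by apply: (@gop_inj _ (badd B') (f x)); rewrite -fD !gopgV.
Qed.

Lemma brace_iso_lambda a b : f (blambda B a b) = blambda B' (f a) (f b).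
Proof. by rewrite /blambda fD fM brace_iso_opp. Qed.

Lemma brace_iso_comm : is_left_brace B' -> is_left_brace B.
Proof. by move=> addC x y; apply: (bij_inj f_bij); rewrite !fD addC. Qed.

Lemma brace_iso_card : #|T| = #|T'|.
Proof. exact: bij_eq_card f_bij. Qed.

Lemma brace_iso_isog :
  [set: carrier (badd B)] \isog [set: carrier (badd B')].
Proof.
have fM' : {in [set: carrier (badd B)] &,
    {morph (f : carrier (badd B) -> carrier (badd B')) : x y / (x * y)%g}}.
  by move=> x y _ _; apply: fD.
apply/isogP; exists (Morphism fM').
  by apply/injmP => x y _ _; apply: (bij_inj f_bij).
apply/setP=> y; rewrite inE; have [g fK gK] := f_bij.
by rewrite -[y]gK; apply: (mem_morphim (Morphism fM')); rewrite inE.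
Qed.

Lemma brace_iso_ker : #|ker_blambda B| = #|ker_blambda B'|.
Proof.
have [g fK gK] := f_bij.
rewrite -(card_imset _ (bij_inj f_bij)); apply: eq_card => y.
rewrite -[y]gK (mem_imset _ _ (bij_inj f_bij)) !inE.
apply/forallP/forallP=> /= ker_y b; apply/eqP.
  by rewrite -[b]gK -brace_iso_lambda (eqP (ker_y _)).
by apply: (bij_inj f_bij); rewrite brace_iso_lambda (eqP (ker_y _)).
Qed.

End BraceIso.

(** * Braces on a product of rings with diagonal lambda *)

Section DiagonalBrace.

Variables (R S : pzRingType) (u : S -> R) (v w : S -> S).
Hypotheses (u0 : u 0 = 1) (v0 : v 0 = 1).
Hypotheses (uM : forall m y, u (m + v m * y) = u m * u y)
  (vM : forall m y, v (m + v m * y) = v m * v y)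
  (wV : forall m, w m + v (w m) * m = 0).

Definition pair_add : group_on (R * S) :=
  GroupOn (@addrA (R * S)%type) (@add0r (R * S)%type) (@addNr (R * S)%type).

(** This is a + lambda_a(b) for lambda_(n,m) = diag(u m, v m). The equations [uM] and [vM] make
    lambda multiplicative for this operation, and [w] inverts its second component. *)
Definition diag_op (a b : R * S) : R * S :=
  (a.1 + u a.2 * b.1, a.2 + v a.2 * b.2).

Lemma diag_opA : associative diag_op.
Proof.
by case=> n m [x y] [z t]; rewrite /diag_op /= uM vM !mulrDr !mulrA !addrA.
Qed.

Lemma diag_op1g : left_id 0 diag_op.
Proof. by case=> n m; rewrite /diag_op /= u0 v0 !mul1r !add0r. Qed.

Definition diag_inv (a : R * S) : R * S := (- (u (w a.2) * a.1), w a.2).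

Lemma diag_opVg : left_inverse 0 diag_inv diag_op.
Proof. by case=> n m; rewrite /diag_op /= addNr wV. Qed.

Definition diag_circ : group_on (R * S) :=
  GroupOn diag_opA diag_op1g diag_opVg.

Lemma diag_braceP : skew_brace_axiom pair_add diag_circ.
Proof.
case=> n m [x y] [z t] /=; rewrite /diag_op /=.
congr (_, _); rewrite /= mulrDr !addrA; congr (_ + _).
  by rewrite [n + _]addrC addrK addrC.
by rewrite [m + _]addrC addrK addrC.
Qed.

Definition diag_brace : skew_brace (R * S) := SkewBrace diag_braceP.

Lemma diag_blambda a b : blambda diag_brace a b = (u a.2 * b.1, v a.2 * b.2).
Proof. by rewrite /blambda /= /diag_op; congr (_, _); rewrite /= addKr. Qed.

End DiagonalBrace.

Variant Z4_spec : 'Z_4 -> Prop :=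
  | Z4_0 : Z4_spec 0 | Z4_1 : Z4_spec 1 | Z4_2 : Z4_spec 2 | Z4_3 : Z4_spec 3.

(** Splitting into ring literals turns identities over ['Z_4] into closed computations. *)
Lemma Z4P m : Z4_spec m.
Proof.
case: m => [[|[|[|[|m]]]] lt_m] //.
- by rewrite (_ : Ordinal _ = 0); [exact: Z4_0 | exact: val_inj].
- by rewrite (_ : Ordinal _ = 1); [exact: Z4_1 | exact: val_inj].
- by rewrite (_ : Ordinal _ = 2); [exact: Z4_2 | exact: val_inj].
- by rewrite (_ : Ordinal _ = 3); [exact: Z4_3 | exact: val_inj].
Qed.

(** * Arithmetic modulo q and 4, and the two model braces *)

Section PrimeModulus.

Variables (q : nat) (q_prime : prime q).
Let q_gt1 : (1 < q)%N. Proof. exact: prime_gt1. Qed.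

Lemma natr_Zp_eq0 n : (n%:R == 0 :> 'Z_q) = (q %| n)%N.
Proof. by rewrite -val_eqE /= val_Zp_nat. Qed.

(** Euclid's lemma for the prime [q], applied to natural representatives. *)
Lemma Zp_mulf_eq0 (x y : 'Z_q) : x * y = 0 -> x = 0 \/ y = 0.
Proof.
rewrite -(natr_Zp x) -(natr_Zp y) -natrM => /eqP.
rewrite natr_Zp_eq0 Euclid_dvdM //.
by rewrite -!natr_Zp_eq0 => /orP[]/eqP ->; [left | right].
Qed.

Lemma Zp_sqr_eq1 (x : 'Z_q) : x * x = 1 -> x = 1 \/ x = -1.
Proof.
move=> x2; have: (x - 1) * (x + 1) = 0 by rewrite mulrDr mulr1 mulrBl x2; ring.
by case/Zp_mulf_eq0 => /eqP; rewrite ?subr_eq0 ?addr_eq0 => /eqP;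
  [left | right].
Qed.

Hypothesis q_mod4 : q = 1 %[mod 4].

Lemma q_gt4 : (4 < q)%N.
Proof. by move: q_mod4 q_gt1; case: q => [|[|[|[|[|]]]]]. Qed.

Lemma coprime_q4 : coprime q 4.
Proof. by rewrite coprime_sym -coprime_modr q_mod4. Qed.

Lemma natr_q_Z4 : q%:R = 1 :> 'Z_4.
Proof. by rewrite -Zp_nat_mod // q_mod4. Qed.

Lemma four_Zq_neq0 : (4%:R : 'Z_q) <> 0.
Proof.
by move/eqP; rewrite natr_Zp_eq0 gtnNdvd // q_gt4.
Qed.

Lemma two_Zq_neq0 : (2%:R : 'Z_q) <> 0.
Proof. by move=> e; apply: four_Zq_neq0; rewrite (natrM _ 2 2) e mul0r. Qed.

Lemma card_Zq4 : #|{: 'Z_q * 'Z_4}| = (4 * q)%N.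
Proof. by rewrite card_prod !card_ord Zp_cast // mulnC. Qed.

Lemma cyclic_pair_add : cyclic [set: carrier (pair_add 'Z_q 'Z_4)].
Proof.
pose a : carrier (pair_add 'Z_q 'Z_4) := (1, 1).
have aX k : (a ^+ k)%g = (k%:R, k%:R).
  elim: k => [|k IHk]; first by [].
  by rewrite expgS IHk ![k.+1%:R]mulrS.
apply/cyclicP; exists a; apply/setP=> -[n m]; rewrite inE; apply/esym/cycleP.
(* By the Chinese remainder theorem (1, 1) generates; this is the exponent that reaches (n, m). *)
exists (chinese q 4 n m); rewrite aX; congr (_, _).
  by rewrite -Zp_nat_mod // chinese_modl ?coprime_q4 // Zp_nat_mod // natr_Zp.
by rewrite -Zp_nat_mod // chinese_modr ?coprime_q4 // Zp_nat_mod // natr_Zp.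
Qed.

(** The exponent is computed in [nat]: it is 0, 0, 1, 3 for m = 0, 1, 2, 3, so the values are 1, 1,
    -1, -1. Truncation of [m - 1] at 0 is harmless because of the factor [m]. *)
Definition u1 (m : 'Z_4) : 'Z_q := (-1) ^+ (m * (m - 1) %/ 2)%N.
Definition v1 (m : 'Z_4) : 'Z_4 := (-1) ^+ m.
Definition w1 (m : 'Z_4) : 'Z_4 := - (v1 m * m).

Lemma u1M m y : u1 (m + v1 m * y) = u1 m * u1 y.
Proof.
(* As [q] is a variable, signs are compared through the parities of their exponents, which do
   compute. *)
rewrite /u1 -exprD -[LHS]signr_odd -[RHS]signr_odd; congr (_ ^+ nat_of_bool _).
by case: (Z4P m); case: (Z4P y).
Qed.

Lemma v1M m y : v1 (m + v1 m * y) = v1 m * v1 y.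
Proof. by apply: val_inj; case: (Z4P m); case: (Z4P y). Qed.

Lemma w1V m : w1 m + v1 (w1 m) * m = 0.
Proof. by apply: val_inj; case: (Z4P m). Qed.

Definition brace1 : skew_brace ('Z_q * 'Z_4) :=
  diag_brace (erefl : u1 0 = 1) (erefl : v1 0 = 1) u1M v1M w1V.

Section SecondBrace.

Variable xi : {unit 'Z_q}.
Hypothesis xi_order : #[xi]%g = 4%N.

Lemma xi_X4 : val xi ^+ 4 = 1.
Proof. by have /(congr1 val) := expg_order xi; rewrite xi_order. Qed.

(** The square of [xi] is a square root of 1, and it is not 1 because the order 4 does not divide
    2. *)
Lemma xi_sqr : val xi ^+ 2 = -1.
Proof.
have := xi_X4; rewrite (exprD _ 2 2) => /Zp_sqr_eq1 [] // xi2.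
have := order_dvdn xi 2; rewrite xi_order => /esym/eqP [].
by apply: val_inj; rewrite /= -xi2.
Qed.

Definition u2 (m : 'Z_4) : 'Z_q := val xi ^+ m.

Lemma u2D m y : u2 (m + y) = u2 m * u2 y.
Proof. by rewrite /u2 -exprD -(expr_mod (m + y)%N xi_X4). Qed.

Lemma u2M m y : u2 (m + 1 * y) = u2 m * u2 y.
Proof. by rewrite mul1r u2D. Qed.

Lemma w2V (m : 'Z_4) : - m + 1 * m = 0.
Proof. by rewrite mul1r addNr. Qed.

Definition brace2 : skew_brace ('Z_q * 'Z_4) :=
  @diag_brace _ _ u2 (fun=> 1) (@GRing.opp _) erefl erefl u2M
    (fun _ _ => esym (mulr1 1)) w2V.

End SecondBrace.
End PrimeModulus.

Lemma pair_mulrn (R S : nmodType) (x : R) (y : S) k :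
  (x, y) *+ k = (x *+ k, y *+ k).
Proof. by elim: k => // k IHk; rewrite !mulrS IHk. Qed.

(** * Shape of lambda when its kernel has order q *)

Section Classification.

Variables (q : nat) (q_prime : prime q) (q_mod4 : q = 1 %[mod 4]).
Local Notation P := ('Z_q * 'Z_4)%type.
Let q_gt1 : (1 < q)%N. Proof. exact: prime_gt1. Qed.

(** The off-diagonal entries vanish: [c] is killed by [q], which is 1 in ['Z_4], and [d] is killed
    by 4, which is nonzero modulo the prime [q]. *)
Lemma Zq4_additive_diag (F : P -> P) : {morph F : a b / a + b} ->
  exists (u : 'Z_q) (v : 'Z_4), forall n m, F (n, m) = (u * n, v * m).
Proof.
move=> FD; have F0 : F 0 = 0 by apply: (addrI (F 0)); rewrite -FD !addr0.
have FX a k : F (a *+ k) = F a *+ k.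
  by elim: k => [|k IHk]; rewrite ?mulr0n // !mulrS FD IHk.
have eF n m : F (n, m) = F (1, 0) *+ n + F (0, 1) *+ m.
  rewrite -!FX -FD !pair_mulrn !natr_Zp !mul0rn.
  by rewrite -[(n, 0) + _]/(n + 0, 0 + m) addr0 add0r.
case F10: (F (1, 0)) eF => [u c] eF; case F01: (F (0, 1)) eF => [d v] eF.
have c0 : c = 0.
  have := FX (1, 0) q; rewrite F10 !pair_mulrn mul0rn pchar_Zp // F0 => -[_].
  by rewrite -mulr_natr natr_q_Z4 // mulr1.
have d0 : d = 0.
  have := FX (0, 1) 4%N; rewrite F01 !pair_mulrn mul0rn (pchar_Zp (isT : 1 < 4)%N).
  rewrite F0 => /pair_equal_spec [/esym d4 _]; move: d4.
  by rewrite -mulr_natr => /(Zp_mulf_eq0 q_prime) [] // /(four_Zq_neq0 q_prime q_mod4).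
exists u, v => n m.
rewrite eF c0 d0 !pair_mulrn -[_ + _]/(u *+ n + 0 *+ m, 0 *+ n + v *+ m).
by rewrite !mul0rn addr0 add0r -(mulr_natr u) -(mulr_natr v) !natr_Zp.
Qed.

(** [L] stands for lambda carried over to [P] by an additive isomorphism; [LM] is its
    multiplicativity for a o b = a + L a b. *)
Variable L : P -> P -> P.
Hypotheses (LD : forall a, {morph L a : b c / b + c})
  (L0 : forall b, L 0 b = b)
  (LM : forall a b c, L (a + L a b) c = L a (L b c))
  (L_inj : forall a, injective (L a)).
Hypothesis card_kerL : #|[set a | [forall b, L a b == b]]| = q.

(** The kernel is an additive subgroup, since a o b = a + b for [a] in it. Having order [q], it lies
    in the [q]-torsion ['Z_q] x 0, and the cardinals agree. *)
Lemma kerLP a : (forall b, L a b = b) <-> a.2 = 0.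
Proof.
pose K := [set a | [forall b, L a b == b]].
have inK c : reflect (forall b, L c b = b) (c \in K).
  by rewrite inE; apply: (iffP forallP) => H b; apply/eqP; rewrite H.
have K_group : group_set (K : {set P}).
  apply/group_setP; split=> [|b c /inK Kb /inK Kc]; first exact/inK/L0.
  by apply/inK=> d; rewrite -[(b * c)%g]/(b + c) -[in b + c](Kb c) LM Kc Kb.
have KsubN : K \subset [set a : P | a.2 == 0].
  apply/subsetP=> b Kb; rewrite inE.
  have := expg_cardG (Kb : b \in Group K_group); rewrite card_kerL.
  have bX k : (b ^+ k)%g = b *+ k by elim: k => // k IHk; rewrite expgS mulrS IHk.
  rewrite bX => /(congr1 snd) /=.
  by rewrite raddfMn -mulr_natr natr_q_Z4 // mulr1 => ->.
have cardN : #|[set a : P | a.2 == 0]| = q.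
  have -> : [set a : P | a.2 == 0] = setX setT [set 0].
    by apply/setP=> -[n m]; rewrite !inE.
  by rewrite cardsX cardsT cards1 muln1 card_ord Zp_cast.
have -> : a.2 = 0 <-> a \in [set a : P | a.2 == 0].
  by rewrite inE; split=> /eqP.
have /eqP <- : K == [set a : P | a.2 == 0].
  by rewrite eqEcard KsubN cardN card_kerL leqnn.
by split=> /inK.
Qed.

Lemma gamma_diag : exists (u : 'Z_4 -> 'Z_q) (v : 'Z_4 -> 'Z_4),
  [/\ forall a b, L a b = (u a.2 * b.1, v a.2 * b.2),
      forall m y, u (m + v m * y) = u m * u y,
      forall m y, v (m + v m * y) = v m * v y,
      forall m, v m = 1 \/ v m = -1
    & forall m, u m = 1 /\ v m = 1 <-> m = 0].
Proof.
(* Here (n, m) = (n, 0) o (0, m) with (n, 0) in the kernel. *)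
have Lsnd n m b : L (n, m) b = L (0, m) b.
  have Kn : forall b, L (n, 0) b = b by apply/kerLP.
  rewrite (_ : (n, m) = (n, 0) + L (n, 0) (0, m)) ?LM ?Kn //.
  by congr (_, _); rewrite /= ?addr0 ?add0r.
pose u m := (L (0, m) (1, 1)).1; pose v m := (L (0, m) (1, 1)).2.
have Luv a b : L a b = (u a.2 * b.1, v a.2 * b.2).
  case: a b => n m [x y]; rewrite Lsnd /u /v.
  by have [c [d LE]] := Zq4_additive_diag (LD (0, m)); rewrite !LE /= !mulr1.
have uvM m y : (u (m + v m * y), v (m + v m * y)) = (u m * u y, v m * v y).
  have := LM (0, m) (0, y) (1, 1).
  by rewrite !Luv /= !mulr1.
exists u, v; split=> //.
- by move=> m y; case: (uvM m y).
- by move=> m y; case: (uvM m y).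
(* Injectivity at (0, 2) excludes the non-units 0 and 2 as values of [v m]. *)
- move=> m; have : L (0, m) (0, 2) <> 0.
    move=> L2; have := @L_inj (0, m) (0, 2) 0.
    by rewrite L2 Luv /= !mulr0 => /(_ erefl).
  rewrite Luv /= mulr0; case: (Z4P (v m)) => nz; try by [left | right; apply: val_inj].
    by case: nz; rewrite mul0r.
  by case: nz; congr (_, _); apply: val_inj.
- move=> m; split=> [[um vm] | ->].
    have /kerLP // : forall b, L (0, m) b = b.
    by case=> n y; rewrite Luv /= um vm !mul1r.
  by rewrite /u /v L0.
Qed.

End Classification.

(** * Solving the functional equations for u and v *)

Section Cocycles.

Variables (q : nat) (q_prime : prime q).
Variables (u : 'Z_4 -> 'Z_q) (v : 'Z_4 -> 'Z_4).
Hypotheses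
  (uM : forall m y, u (m + v m * y) = u m * u y)
  (vM : forall m y, v (m + v m * y) = v m * v y)
  (v_pm1 : forall m, v m = 1 \/ v m = -1)
  (uv_faithful : forall m, u m = 1 /\ v m = 1 <-> m = 0).

(** The sign [s] is the automorphism of ['Z_4] that brings (u, v) to one of the two model pairs. *)
Lemma cocycle_classification (xi : {unit 'Z_q}) : #[xi]%g = 4%N ->
  exists2 s : 'Z_4, s * s = 1 &
    (forall m, u (s * m) = u1 q m) /\ (forall m, v (s * m) = v1 m) \/
    (forall m, u (s * m) = u2 xi m) /\ (forall m, v (s * m) = 1).
Proof.
move=> xi_order; have xi2 := xi_sqr q_prime xi_order.
have [u_0 v_0] := (uv_faithful 0).2 erefl.
(* In this form the product m o y is named [z] in advance and checked by computation in ['Z_4]. *)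
have uE m y z : m + v m * y = z -> u z = u m * u y by move <-.
have vE m y z : m + v m * y = z -> v z = v m * v y by move <-.
have Z4E (a b : 'Z_4) : a == b -> a = b by move/eqP.
case: (v_pm1 1) => v_1.
  have v_2 : v 2 = 1 by rewrite (vE 1 1 2) v_1 ?mulr1 //; apply: Z4E.
  have v_3 : v 3 = 1 by rewrite (vE 1 2 3) v_1 ?v_2 ?mulr1 //; apply: Z4E.
  have u_2 : u 2 = u 1 * u 1 by apply: uE; rewrite v_1; apply: Z4E.
  have u_3 : u 3 = u 1 * u 2 by apply: uE; rewrite v_1; apply: Z4E.
  have u_4 : 1 = u 2 * u 2 by rewrite -u_0; apply: uE; rewrite v_2; apply: Z4E.
  have u_2N : u 2 = -1.
    case: (Zp_sqr_eq1 q_prime (esym u_4)) => // u_21.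
    by have /uv_faithful := conj u_21 v_2.
  (* Both [u 1] and [xi] square to -1; the sign between them determines [s]. *)
  have [] : u 1 - val xi = 0 \/ u 1 + val xi = 0.
  - by apply: (Zp_mulf_eq0 q_prime); rewrite -subr_sqr xi2 expr2 -u_2 u_2N subrr.
  - move/subr0_eq => u_1; exists 1; first exact: Z4E.
    right; split=> m; rewrite mul1r; last by case: (Z4P m).
    case: (Z4P m); rewrite ?u_0 ?u_3 ?u_2N ?u_1 /u2 ?expr0 ?expr1 ?xi2 //.
    by rewrite exprS xi2.
  - move/addr0_eq => u_1; have {}u_1 : u 1 = - val xi by rewrite -u_1 opprK.
    exists (-1); first exact: Z4E.
    right; split=> m; case: (Z4P m).
    + by rewrite mulr0.
    + by rewrite (_ : -1 * 1 = 3) ?u_3 ?u_2N ?u_1 ?mulrN1 ?opprK //; apply: Z4E.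
    + by rewrite (_ : -1 * 2 = 2) ?u_2N -?xi2 //; apply: Z4E.
    + rewrite (_ : -1 * 3 = 1) ?u_1; last exact: Z4E.
      by rewrite /u2 /= exprS xi2 mulrN1.
    + by rewrite mulr0.
    + by rewrite (_ : -1 * 1 = 3) //; apply: Z4E.
    + by rewrite (_ : -1 * 2 = 2) //; apply: Z4E.
    + by rewrite (_ : -1 * 3 = 1) //; apply: Z4E.
(* If [v 3] were 1, then 3 o 3 = 2 and 3 o 2 = 1 would force [v 1] = 1. *)
case: (v_pm1 3) => v_3.
  have v_2 : v 2 = v 3 * v 3 by apply: vE; rewrite v_3; apply: Z4E.
  have : v 1 = v 3 * v 2 by apply: vE; rewrite v_3; apply: Z4E.
  by rewrite v_1 v_2 v_3.
have v_2 : v 2 = 1.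
  by rewrite (vE 1 3 2) v_1 ?v_3; apply: Z4E.
have u_11 : 1 = u 1 * u 1 by rewrite -u_0; apply: uE; rewrite v_1; apply: Z4E.
have u_3 : u 3 = u 1 * u 2 by apply: uE; rewrite v_1; apply: Z4E.
have u_22 : 1 = u 2 * u 2 by rewrite -u_0; apply: uE; rewrite v_2; apply: Z4E.
have u_2 : u 2 = -1.
  case: (Zp_sqr_eq1 q_prime (esym u_22)) => // u_21.
  by have /uv_faithful := conj u_21 v_2.
have v1E m : v m = v1 m by apply: Z4E; case: (Z4P m); rewrite ?v_0 ?v_1 ?v_2 ?v_3.
(* Since [u 3] = - [u 1], exactly one of the two is 1, and [s] moves it to position 1. *)
case: (Zp_sqr_eq1 q_prime (esym u_11)) => u_1.
  exists 1; first exact: Z4E.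
  left; split=> m; rewrite mul1r //.
  by case: (Z4P m); rewrite ?u_0 ?u_3 ?u_1 ?u_2 ?mul1r /u1 //= -signr_odd.
exists (-1); first exact: Z4E.
left; split=> m; last by rewrite v1E; apply: Z4E; case: (Z4P m).
case: (Z4P m).
- by rewrite mulr0.
- by rewrite (_ : -1 * 1 = 3) ?u_3 ?u_1 ?u_2 ?mulrNN ?mulr1 //; apply: Z4E.
- by rewrite (_ : -1 * 2 = 2) ?u_2 //; apply: Z4E.
- rewrite (_ : -1 * 3 = 1) ?u_1; last exact: Z4E.
  by rewrite /u1 -signr_odd.
Qed.

End Cocycles.

Lemma card_carrier (T : finType) (G : group_on T) : #|{: carrier G}| = #|T|.
Proof. by apply: (@bij_eq_card (carrier G) T id); exists id. Qed.

(** Being an image of a presented group unfolds to the existence of generators satisfying the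
    relations. *)
Lemma homg_Grp_of_relations (gT : finGroupType) (G : {group gT}) (s t : gT)
    (k l r : nat) :
    (<[s]> <*> <[t]> = G)%g -> (s ^+ k = 1)%g -> (t ^+ l = 1)%g ->
    (s * t * s^-1 = t ^+ r)%g ->
  (G \homg Grp (s : t : s ^+ k = t ^+ l = 1, s * t * s^-1 = t ^+ r))%g.
Proof.
move=> defG sk tl st; apply/existsP; exists (s, t).
by rewrite /= defG sk tl st !eqxx.
Qed.

(** * Exponents taken modulo p *)

Section ExpZp.

Variables (gT : finGroupType) (p : nat) (x : gT).
Hypotheses (p_gt1 : (1 < p)%N) (x_p : (x ^+ p = 1)%g).

Lemma expg_Zp_nat k : (x ^+ (k%:R : 'Z_p) = x ^+ k)%g.
Proof. by rewrite val_Zp_nat // expg_mod. Qed.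

Lemma expg_ZpD (a b : 'Z_p) : (x ^+ (a + b)%R = x ^+ a * x ^+ b)%g.
Proof. by rewrite -{1}(natr_Zp a) -{1}(natr_Zp b) -natrD expg_Zp_nat expgD. Qed.

Lemma expg_ZpN (a : 'Z_p) : (x ^+ (- a)%R = x ^- a)%g.
Proof. by apply: (mulIg (x ^+ a)%g); rewrite -expg_ZpD addNr mulVg. Qed.

End ExpZp.

(** * Classification up to isomorphism, and the circle groups *)

Section Braces.

Variables (q : nat) (q_prime : prime q) (q_mod4 : q = 1 %[mod 4]).
Local Notation P := ('Z_q * 'Z_4)%type.
Let q_gt1 : (1 < q)%N. Proof. exact: prime_gt1. Qed.
Variables (xi : {unit 'Z_q}) (xi_order : #[xi]%g = 4%N).
Local Notation B1 := (brace1 q).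
Local Notation B2 := (brace2 xi_order).

(** The isomorphism is [f] followed by diag(1, s), an additive involution that turns (u, v) into
    (u', v'). *)
Lemma brace_iso_twist (T : finType) (B : skew_brace T) (B' : skew_brace P)
    (f : T -> P) (u u' : 'Z_4 -> 'Z_q) (v v' : 'Z_4 -> 'Z_4) (s : 'Z_4) :
    bijective f ->
    {morph f : x y / gop (badd B) x y >-> x + y} ->
    {morph f : x y / gop (bcirc B) x y >-> diag_op u v x y} ->
    gop (badd B') =2 +%R -> gop (bcirc B') =2 diag_op u' v' ->
    s * s = 1 ->
    (forall m, u (s * m) = u' m) -> (forall m, v (s * m) = v' m) ->
  brace_iso B B'.
Proof.
move=> [g fK gK] fD fM B'D B'M ss1 uE vE.
exists (fun t => ((f t).1, s * (f t).2)); split.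
- exists (fun a => g (a.1, s * a.2)) => [t | [n m]] /=.
    by rewrite mulrA ss1 mul1r -surjective_pairing fK.
  by rewrite gK /= mulrA ss1 mul1r.
- by move=> x y; rewrite B'D fD /= mulrDr.
- move=> x y; rewrite B'M fM /diag_op /= -uE -vE mulrA ss1 mul1r.
  by rewrite mulrDr !mulrA [s * v _]mulrC.
Qed.

Lemma brace_iso_of_cyclic (T : finType) (B : skew_brace T) :
    #|T| = (4 * q)%N -> cyclic [set: carrier (badd B)] ->
    #|ker_blambda B| = q ->
  brace_iso B B1 \/ brace_iso B B2.
Proof.
move=> cardT cycT card_ker.
have /isogP[F injF imF] :
    [set: carrier (badd B)] \isog [set: carrier (pair_add 'Z_q 'Z_4)].
  rewrite isog_cyclic_card // cyclic_pair_add //= !cardsT.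
  by rewrite !card_carrier card_Zq4 // cardT.
pose f : T -> P := F.
have f_inj : injective f by move=> x y /(injmP injF); rewrite !inE => ->.
have fD : {morph f : x y / gop (badd B) x y >-> x + y}.
  by move=> x y; apply: (morphM F); rewrite inE.
have [g fK gK] : bijective f.
  by apply: inj_card_bij => //; rewrite card_Zq4 // cardT.
have f0 : f (gid (badd B)) = 0 by apply: (morph1 F).
pose L a b := f (blambda B (g a) (g b)).
have gD a b : g (a + b) = gop (badd B) (g a) (g b).
  by apply: f_inj; rewrite fD !gK.
have fM x y : f (gop (bcirc B) x y) = f x + L (f x) (f y).
  by rewrite circE fD /L !fK.
have [||||| u [v [LE uM vM v_pm1 uv1]]] := @gamma_diag q q_prime q_mod4 L.
- by move=> a b c; rewrite /L gD blambdaD fD.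
- by move=> b; rewrite /L -f0 fK blambda_id gK.
- move=> a b c; rewrite {1}/L.
  have -> : g (a + L a b) = gop (bcirc B) (g a) (g b).
    by apply: f_inj; rewrite fM !gK.
  by rewrite blambda_circ /L fK.
- move=> a b c /f_inj eq_bc.
  exact: (can_inj gK) (blambda_inj eq_bc).
(* The kernel of [L] is the image under [f] of the kernel of lambda. *)
- apply: etrans card_ker; rewrite -[RHS](card_imset _ f_inj); apply: eq_card => a.
  rewrite -[in RHS](gK a) mem_imset // !inE.
  apply/forallP/forallP=> /= ker_a b; apply/eqP.
    by apply: f_inj; have /eqP := ker_a (f b); rewrite /L fK.
  by rewrite /L (eqP (ker_a _)) gK.
have fdiag : {morph f : x y / gop (bcirc B) x y >-> diag_op u v x y}.
  by move=> x y; rewrite fM LE.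
have f_bij : bijective f by exists g.
have [s ss1] := cocycle_classification q_prime uM vM v_pm1 uv1 xi_order.
by case=> -[uE vE]; [left | right];
  apply: (brace_iso_twist f_bij fD fdiag _ _ ss1 uE vE).
Qed.

Lemma card_ker_diag (B : skew_brace P) (u : 'Z_4 -> 'Z_q) (v : 'Z_4 -> 'Z_4) :
    (forall a b, blambda B a b = (u a.2 * b.1, v a.2 * b.2)) ->
    (forall m, u m = 1 /\ v m = 1 <-> m = 0) ->
  #|ker_blambda B| = q.
Proof.
move=> BE uv1; have -> : ker_blambda B = setX setT [set 0].
  apply/setP=> -[n m]; rewrite !inE /=; apply/forallP/eqP => [H | m0 [x y]].
    apply/uv1; have /eqP := H (1, 1).
    by rewrite BE /= !mulr1 => -[].
  by have [u_1 v_1] := (uv1 m).2 m0; rewrite BE /= u_1 v_1 !mul1r.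
by rewrite cardsX cardsT cards1 muln1 card_ord Zp_cast.
Qed.

Lemma Zq_N1_neq1 : (-1 : 'Z_q) <> 1.
Proof.
move=> N1; apply: (two_Zq_neq0 q_prime q_mod4).
by rewrite mulr2n -[X in X + _]N1 addNr.
Qed.

Lemma card_ker_brace1 : #|ker_blambda B1| = q.
Proof.
apply: (card_ker_diag (diag_blambda _ _ _ _ _)) => m.
split=> [|->]; last by [].
case: (Z4P m) => // -[] //.
by rewrite /u1 => /Zq_N1_neq1.
Qed.

Lemma card_ker_brace2 : #|ker_blambda B2| = q.
Proof.
apply: (card_ker_diag (diag_blambda _ _ _ _ _)) => m.
split=> [[um _]|->]; last by [].
apply/eqP; rewrite -val_eqE /= -[_ == _]/(val m == 0)%N.
(* Among the representatives 0, 1, 2, 3 only 0 is a multiple of 4. *)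
suff : (#[xi]%g %| m)%N by rewrite xi_order; case: (Z4P m).
rewrite order_dvdn; apply/eqP/val_inj.
by rewrite FinRing.val_unitX.
Qed.

Lemma diag_brace_iso_props (T : finType) (B : skew_brace T)
    (B' : skew_brace P) :
    badd B' = pair_add 'Z_q 'Z_4 -> #|ker_blambda B'| = q -> brace_iso B B' ->
  [/\ is_left_brace B, #|T| = (4 * q)%N, cyclic [set: carrier (badd B)]
    & #|ker_blambda B| = q].
Proof.
move=> B'D card_ker [f [f_bij fD fM]]; split.
- by apply: brace_iso_comm f_bij fD _; rewrite /is_left_brace B'D; apply: addrC.
- by rewrite (brace_iso_card f_bij) card_Zq4.
- rewrite (isog_cyclic (brace_iso_isog f_bij fD)) B'D.
  exact: cyclic_pair_add.
- by rewrite (brace_iso_ker f_bij fD fM).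
Qed.

Lemma brace1_not_iso_brace2 : ~ brace_iso B1 B2.
Proof.
move=> [f [[g fK gK] fD fM]].
have lam2 (x y : P) : blambda B1 (gop (bcirc B1) x x) y = y.
  rewrite blambda_circ !diag_blambda; case: x y => n m [z t] /=.
  rewrite !mulrA; congr (_, _).
    by rewrite -exprD addnn -signr_odd odd_double mul1r.
  by apply: val_inj; case: (Z4P m); case: (Z4P t).
(* In [B2] the circle square of (0, 1) is (0, 2), which multiplies first components by xi^2 = -1. *)
have := congr1 f (lam2 (g (0, 1)) (g (1, 0))).
rewrite (brace_iso_lambda fD fM) fM !gK diag_blambda /=.
move=> /(congr1 fst) /=; rewrite mulr1.
by rewrite -[u2 _ _]/(val xi ^+ 2) xi_sqr // => /Zq_N1_neq1.
Qed.

(** [u2] is a homomorphism for addition as well, so [u2 xi (m + y)] times [u2 xi (- m)] is [u2 xi y]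
    and the terms in [n] cancel. *)
Lemma brace2_bi_skew : is_bi_skew_brace B2.
Proof.
case=> n m [x y] [z t] /=; rewrite /diag_op /diag_inv /=.
have uE : n + (x + u2 xi y * z) =
    n + x + u2 xi (m + y) * - (u2 xi (- m) * n) + u2 xi (m + y - m) * (n + z).
  rewrite mulrN mulrA -u2D // [m + y - m]addrAC subrr add0r mulrDr.
  by rewrite !addrA addrNK.
by congr (_, _) => /=; rewrite ?mul1r //= !addrA addrNK.
Qed.

Lemma expg_signZ (gT : finGroupType) (x : gT) (e : nat) (a : 'Z_q) :
  (x ^+ q = 1)%g ->
  (x ^+ ((-1) ^+ e * a)%R = if odd e then x ^- a else x ^+ a)%g.
Proof.
move=> xq; rewrite -signr_odd; case: (odd e); last by rewrite mul1r.
by rewrite mulN1r expg_ZpN.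
Qed.

(** The map sends (n, m) to (m mod 2, x^n y^(e m)), where [e m] is the exponent of the sign
    [u1 q m], so that conjugation by y^(e m) acts as [u1 q m]. It is onto, hence bijective as both
    sides have order 4q. *)
Lemma brace1_circ_isog :
  [set: carrier (bcirc B1)] \isog [set: 'Z_2 * 'D_(2 * q)%N]%g.
Proof.
have: 'D_(2 * q) \homg Grp (x : y : x ^+ q, y ^+ 2, x ^ y = x^-1)%g.
  by rewrite mul2n -Grp_dihedral // homg_refl.
case/existsP=> -[x y] /eqP[/= defD xq y2 xy].
have yxk k : (y * x ^+ k = x ^- k * y)%g.
  rewrite -expgVn -xy -conjXg conjgE.
  have -> : (y^-1 = y)%g by apply/eqP; rewrite eq_invg_mul -expg2 y2.
  by rewrite -!mulgA -expg2 y2 mulg1.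
have yexk j k : (y ^+ j * x ^+ k = (if odd j then x ^- k else x ^+ k) * y ^+ j)%g.
  rewrite -(expg_mod j y2) modn2.
  by case: (odd j); rewrite ?expg1 ?yxk // mul1g mulg1.
pose e (m : 'Z_4) := (m * (m - 1) %/ 2)%N.
have yeM m l : (y ^+ e (m + v1 m * l)%R = y ^+ e m * y ^+ e l)%g.
  rewrite -expgD -(expg_mod _ y2) -[RHS](expg_mod _ y2); congr (_ ^+ _)%g.
  by case: (Z4P m); case: (Z4P l).
have xyM (n k : 'Z_q) (m l : 'Z_4) :
  (x ^+ (n + u1 q m * k)%R * y ^+ e (m + v1 m * l)%R =
    x ^+ n * y ^+ e m * (x ^+ k * y ^+ e l))%g.
  rewrite expg_ZpD // expg_signZ // yeM -!mulgA; congr (_ * _)%g.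
  by rewrite !mulgA -yexk.
pose f (a : carrier (bcirc B1)) : 'Z_2 * 'D_(2 * q) :=
  ((a.2 : nat)%:R, (x ^+ a.1 * y ^+ e a.2)%g).
have fM : {in [set: carrier (bcirc B1)] &, {morph f : a b / (a * b)%g}}.
  move=> [n m] [k l] _ _; congr (_, _) => /=.
    by apply: val_inj; case: (Z4P m); case: (Z4P l).
  exact: xyM.
pose F := Morphism fM.
have imF : (F @* [set: carrier (bcirc B1)])%g = [set: 'Z_2 * 'D_(2 * q)].
  apply/setP=> -[a d]; rewrite inE.
  pose M := (F @* [set: carrier (bcirc B1)])%G; rewrite -[(_ @* _)%g]/(gval M).
  have Fin b : f b \in M.
    by apply: (mem_morphim F); rewrite inE.
  have Mx : pair1g _ x \in M.
    rewrite (_ : pair1g _ x = f (1, 0)) //; congr (_, _).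
    by rewrite /= expg0 mulg1 modn_small.
  (* At m = 2 the parity is even while [e 2] = 1, which isolates [y]. *)
  have My : pair1g _ y \in M.
    rewrite (_ : pair1g _ y = f (0, 2)) //; congr (_, _); first exact: val_inj.
    by rewrite /= expg0 mul1g expg1.
  have Md : pair1g _ d \in M.
    suff: d \in (@pair1g _ _ @*^-1 M)%g by rewrite !inE.
    have: d \in (<[x]> <*> <[y]>)%g by rewrite defD inE.
    apply/subsetP; rewrite join_subG !cycle_subG !inE Mx.
    exact: My.
  (* For [a] = 0 or 1 the exponent [e a] is 0, so this image lies in the factor ['Z_2]. *)
  have -> : (a, d) = (f (0, inZp a) * pair1g _ d)%g.
    congr (_, _); rewrite /= ?mulg1 ?expg0 ?mul1g.
      by apply: val_inj; case: a => [[|[|]]].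
    by case: a => [[|[|]]] // a_lt; rewrite /= expg0 mul1g.
  by rewrite groupM.
apply/isogP; exists F => //.
have cardD : #|{: 'D_(2 * q)}| = (2 * q)%N.
  by rewrite -cardsT mul2n card_dihedral.
rewrite -card_im_injm imF !cardsT card_carrier card_Zq4 //.
by rewrite card_prod card_ord cardD mulnA.
Qed.

(** Two halves: the circle group satisfies the relations, and it maps onto every group [H] that
    does, by sending (n, m) to t^n s^m. *)
Lemma brace2_circ_isog_Grp :
  ([set: carrier (bcirc B2)] \isog
     Grp (s : t : s ^+ 4 = t ^+ q = 1, s * t * s^-1 = t ^+ (val xi : nat)))%g.
Proof.
apply: intro_isoGrp => [|gT H].
  pose s : carrier (bcirc B2) := (0, 1); pose t : carrier (bcirc B2) := (1, 0).
  have sX k : (s ^+ k)%g = (0, k%:R).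
    elim: k => // k IHk; rewrite expgS IHk mulrS.
    by rewrite -[(s * _)%g]/(0 + u2 xi 1 * 0, 1 + 1 * k%:R) mulr0 add0r mul1r.
  have tX k : (t ^+ k)%g = (k%:R, 0).
    elim: k => // k IHk; rewrite expgS IHk mulrS.
    by rewrite -[(t * _)%g]/(1 + u2 xi 0 * k%:R, 0 + 1 * 0) mulr0 add0r mul1r.
  have tsE n m : (t ^+ n * s ^+ m)%g = (n%:R, m%:R).
    rewrite sX tX -[(_ * _)%g]/(n%:R + u2 xi 0 * 0, 0 + 1 * m%:R).
    by rewrite mulr0 addr0 add0r mul1r.
  have st : (s * t = t ^+ (val xi : nat) * s)%g.
    rewrite -{2}(expg1 s) tsE natr_Zp.
    rewrite -[(s * t)%g]/(0 + u2 xi 1 * 1, 1 + 1 * 0) mulr0 addr0 add0r mulr1.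
    by rewrite /u2 expr1.
  apply: (@homg_Grp_of_relations _ _ s t).
  - apply/setP=> -[n m]; rewrite !inE.
    have -> : (n, m) = (t ^+ n * s ^+ m)%g by rewrite tsE !natr_Zp.
    by apply: groupM; rewrite mem_gen // inE mem_cycle ?orbT.
  - by rewrite sX (pchar_Zp (isT : 1 < 4)%N).
  - by rewrite tX pchar_Zp.
  - by rewrite st mulgK.
case/existsP=> -[s t] /eqP[/= defH s4 tq st].
have stJ : (t ^ s^-1 = t ^+ (val xi : nat))%g by rewrite conjgE invgK mulgA.
(* Each [s] moved past a power of [t] multiplies its exponent by [xi]. *)
have sjt j k : (s ^+ j * t ^+ k = t ^+ ((val xi : nat) ^ j * k)%N * s ^+ j)%g.
  elim: j => [|j IHj]; first by rewrite mul1n mul1g mulg1.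
  rewrite expgS -mulgA IHj mulgA [(s * _)%g]conjgCV conjXg stJ -expgM.
  by rewrite mulnA -expnS mulgA.
pose f (a : carrier (bcirc B2)) : gT := (t ^+ a.1 * s ^+ a.2)%g.
have tsM (n x : 'Z_q) (m y : 'Z_4) :
  (t ^+ (n + u2 xi m * x)%R * s ^+ (m + 1 * y)%R =
    t ^+ n * s ^+ m * (t ^+ x * s ^+ y))%g.
  (* As the cast of a natural number, this exponent can be used without reduction because t^q =
     1. *)
  have -> : u2 xi m * x = ((val xi : nat) ^ m * x)%:R.
    by rewrite natrM natrX !natr_Zp.
  rewrite mul1r (expg_ZpD _ s4) // expg_ZpD // expg_Zp_nat // -!mulgA.
  by congr (_ * _)%g; rewrite !mulgA sjt.
have fM : {in [set: carrier (bcirc B2)] &, {morph f : a b / (a * b)%g}}.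
  by move=> [n m] [x y] _ _; apply: tsM.
have fin a : f a \in (Morphism fM @* [set: carrier (bcirc B2)])%g.
  by apply: (mem_morphim (Morphism fM)); rewrite inE.
apply/homgP; exists (Morphism fM); apply/eqP; rewrite eqEsubset.
apply/andP; split.
  apply/subsetP=> _ /morphimP[a _ _ ->]; rewrite -defH.
  by apply: groupM; rewrite mem_gen // inE mem_cycle ?orbT.
rewrite -defH join_subG !cycle_subG; apply/andP; split.
  by rewrite (_ : s = f (0, 1)) // /f /= mul1g expg1.
by rewrite (_ : t = f (1, 0)) // /f /= mulg1 modn_small.
Qed.

End Braces.

Theorem lemma8p1 (q : nat) (q_prime : prime q) (q_mod4 : q = 1 %[mod 4])
    (xi : {unit 'Z_q}) (xi_order : #[xi]%g = 4%N) :
  exists B1 B2 : skew_brace ('Z_q * 'Z_4)%type,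
  [/\ (forall (n x : 'Z_q) (m y : 'Z_4),
         gop (badd B1) (n, m) (x, y) = (n + x, m + y) /\
         gop (bcirc B1) (n, m) (x, y) =
           (n + (-1) ^+ (m * (m - 1) %/ 2)%N * x, m + (-1) ^+ m * y)),
      (forall (n x : 'Z_q) (m y : 'Z_4),
         gop (badd B2) (n, m) (x, y) = (n + x, m + y) /\
         gop (bcirc B2) (n, m) (x, y) = (n + val xi ^+ m * x, m + y)),
      (forall (T : finType) (B : skew_brace T),
         [/\ is_left_brace B,
             #|T| = (4 * q)%N,
             cyclic [set: carrier (badd B)]
           & #|ker_blambda B| = q] <->
         (brace_iso B B1 \/ brace_iso B B2)),
      ~ brace_iso B1 B2
    & [/\ is_bi_skew_brace B2,
          [set: carrier (bcirc B1)] \isog [set: 'Z_2 * 'D_(2 * q)%N]%g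
        & ([set: carrier (bcirc B2)] \isog
             Grp (s : t : s ^+ 4 = t ^+ q = 1,
                          s * t * s^-1 = t ^+ (val xi : nat)))%g]].
Proof.
exists (brace1 q), (brace2 xi_order); split.
- by [].
- by move=> n x m y; split; rewrite //= /diag_op /= mul1r.
- move=> T B; split=> [[_ cardT cycT card_ker] | ].
    exact: brace_iso_of_cyclic.
  case; apply: diag_brace_iso_props => //.
    exact: card_ker_brace1.
  exact: card_ker_brace2.
- exact: brace1_not_iso_brace2.
split; first exact: brace2_bi_skew.
  exact: brace1_circ_isog.
exact: brace2_circ_isog_Grp.
Qed.
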